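(* Let $n\ge 4$, $0\le k\le n-2$, and let $G\in\mathfrak{H}_{n,k}$, i.e. $G$ is a connected graph on $n$ vertices with exactly $k$ pendant vertices. Then: (i) For $0\le k\le n-3$, $W(P_n^k)\le W(G)$, and equality holds if and only if $G=P_n^k$. Furthermore, $W(P_n^k)=\binom{n-k}{2}+k^2+2k(n-k-1)$. (ii) For $k=n-2$, $W(T(1,n-3,2))\le W(G)$, and equality holds if and only if $G=T(1,n-3,2)$. Furthermore, $W(T(1,n-3,2))=n^2-n-2$.
   Context: All graphs are finite, simple, connected and undirected; equality of graphs means isomorphism. The Wiener index of a connected graph $G$ is $W(G)=\sum_{\{u,v\}\subseteq V(G)}d_G(u,v)$, where the sum is over unordered pairs of vertices and $d_G$ is the shortest-path distance. A pendant vertex is a vertex of degree one. $\mathfrak{H}_{n,k}$ is the class of all connected graphs on $n$ vertices with exactly $k$ pendant vertices. For $0\le k\le n-3$ and $n\ge 4$, $P_n^k$ is the graph obtained by adding $k$ pendant vertices at one vertex of the complete graph $K_{n-k}$. For positive integers $a,b,d$, $T(a,b,d)$ is the tree on $a+b+d$ vertices obtained from the path $v_1v_2\ldots v_d$ on $d$ vertices by adding $a$ pendant vertices adjacent to $v_1$ and $b$ pendant vertices adjacent to $v_d$. *)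

(* Defs.v *)
From HB Require Import structures.
From mathcomp Require Import all_boot.

Set Implicit Arguments.
Unset Strict Implicit.
Unset Printing Implicit Defensive.

Record sgraph := SGraph {
  vertex :> finType;
  adj : rel vertex;
  adj_sym : symmetric adj;
  adj_irrefl : irreflexive adj }.

Definition isomorphic (G H : sgraph) : Prop :=
  exists2 f : G -> H, bijective f & forall x y, adj (f x) (f y) = adj x y.

Definition connected (G : sgraph) : Prop := forall x y : G, connect (@adj G) x y.

Definition degree (G : sgraph) (x : G) : nat := #|[set y | adj x y]|.

Definition pendant (G : sgraph) (x : G) : bool := degree x == 1.

Definition in_H (n k : nat) (G : sgraph) : Prop :=
  [/\ connected G, #|G| = n & #|[set x : G | pendant x]| = k].

Definition joined_by_path (G : sgraph) (x y : G) (m : nat) : bool :=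
  [exists p : m.-tuple G, [&& path (@adj G) x p, last x p == y & uniq (x :: p)]].

(* A path has at most [#|G| - 1] edges, so this is the length of a shortest
   path whenever [x] and [y] are connected; otherwise it is [#|G|]. *)
Definition dist (G : sgraph) (x y : G) : nat :=
  find (joined_by_path x y) (iota 0 #|G|).

Lemma distP (G : sgraph) (x y : G) : connect (@adj G) x y ->
  joined_by_path x y (dist x y) /\
  forall m, joined_by_path x y m -> dist x y <= m.
Proof.
move=> /connectP[p0 p0P ->]; set z := last x p0.
have [m mG zP] : exists2 m, m < #|G| & joined_by_path x z m.
  rewrite /z; case: (shortenP p0P) => p pP pU _.
  exists (size p); first by have /card_uniqP /= <- := pU; exact: max_card.
  by apply/existsP; exists (in_tuple p); apply/and3P; split.
have hasP : has (joined_by_path x z) (iota 0 #|G|).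
  by apply/hasP; exists m; rewrite // mem_iota add0n.
have ltG : dist x z < #|G| by rewrite -[X in _ < X](size_iota 0) -has_find.
split=> [|j jP].
  by have := nth_find 0 hasP; rewrite nth_iota // add0n.
rewrite leqNgt; apply/negP=> ltj; have := before_find 0 ltj.
by rewrite nth_iota ?add0n ?jP // (ltn_trans ltj).
Qed.

(* The comparison of ranks selects each unordered pair of distinct vertices
   exactly once; [dist] is symmetric, so the choice of order is immaterial. *)
Definition wiener (G : sgraph) : nat :=
  \sum_(p : G * G | enum_rank p.1 < enum_rank p.2) dist p.1 p.2.

Lemma joined_by_pathC (G : sgraph) (x y : G) m :
  joined_by_path x y m -> joined_by_path y x m.
Proof.
case/existsP=> p /and3P[pP /eqP <- pU].
have sP : size (rev (belast x p)) == m by rewrite size_rev size_belast size_tuple.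
apply/existsP; exists (Tuple sP); rewrite /= rev_path.
have -> : path (fun a b => adj b a) x p.
  by rewrite (eq_path (e' := @adj G)) // => a b; rewrite adj_sym.
rewrite mem_rev rev_uniq -rcons_uniq -lastI pU andbT /=.
by case: (tval p) => //= a s; rewrite rev_cons last_rcons eqxx.
Qed.

Lemma distC (G : sgraph) (x y : G) : dist x y = dist y x.
Proof.
by apply: eq_find => m; apply/idP/idP; exact: joined_by_pathC.
Qed.

Section AddVertices.
Variables (G : sgraph) (I : finType) (r : I -> pred G).

(* The new vertices, indexed by [I], are pairwise nonadjacent; [i] is adjacent
   to the vertices of [G] satisfying [r i]. *)
Definition add_adj (u v : G + I) : bool :=
  match u, v with
  | inl x, inl y => adj x y
  | inl x, inr i | inr i, inl x => r i x
  | inr _, inr _ => false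
  end.

Lemma add_adj_sym : symmetric add_adj.
Proof. by case=> [x|i] [y|j] //=; rewrite adj_sym. Qed.

Lemma add_adj_irrefl : irreflexive add_adj.
Proof. by case=> [x|i] //=; rewrite adj_irrefl. Qed.

Definition add_vertices : sgraph := SGraph add_adj_sym add_adj_irrefl.

End AddVertices.

Section CompleteAndPath.
Variable n : nat.

Definition complete_adj (i j : 'I_n) : bool := i != j.

Lemma complete_adj_sym : symmetric complete_adj.
Proof. by move=> i j; rewrite /complete_adj eq_sym. Qed.

Lemma complete_adj_irrefl : irreflexive complete_adj.
Proof. by move=> i; rewrite /complete_adj eqxx. Qed.

Definition complete_graph : sgraph := SGraph complete_adj_sym complete_adj_irrefl.

Definition path_adj (i j : 'I_n) : bool := (i.+1 == j) || (j.+1 == i).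

Lemma path_adj_sym : symmetric path_adj.
Proof. by move=> i j; rewrite /path_adj orbC. Qed.

Lemma path_adj_irrefl : irreflexive path_adj.
Proof. by move=> i; rewrite /path_adj orbb eqn_leq ltnn. Qed.

Definition path_graph : sgraph := SGraph path_adj_sym path_adj_irrefl.

End CompleteAndPath.

(* [P_n^k], for [k < n]: the distinguished vertex of [K_(n-k)] is [0]. *)
Definition graphP (n k : nat) : sgraph :=
  @add_vertices (complete_graph (n - k)) 'I_k (fun _ v => val v == 0).

(* [T(a,b,d)], for [0 < d]: the path vertices [v_1], ..., [v_d] are numbered
   [0], ..., [d - 1]. *)
Definition graphT (a b d : nat) : sgraph :=
  @add_vertices (path_graph d) ('I_a + 'I_b)%type
    (fun i v => match i with
                | inl _ => val v == 0
                | inr _ => (val v).+1 == d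
                end).

(* Main.v *)
(* For k <= n - 3, count ordered pairs. Call two distinct vertices close if they
   are adjacent or both nonpendant. Distinct vertices that are not close are at
   distance at least 2, so dist + close >= 2 on every such pair, while the
   number of close pairs, (n - k)(n - k - 1) + 2k, depends on n and k only. This
   bounds W from below. Equality means that the nonpendant vertices form a
   clique and that the diameter is at most 2, whence all pendant vertices hang
   at the same vertex.

   For k = n - 2, the two nonpendant vertices are adjacent and G = T(a,b,2)
   with a, b >= 1 and a + b = n - 2; its Wiener index (a + b + 1)^2 + ab is
   smallest exactly when a or b is 1. *)
Require Import Defs.
From mathcomp Require Import all_boot.
From mathcomp Require Import zify.

Set Implicit Arguments.
Unset Strict Implicit.
Unset Printing Implicit Defensive.

(** * Shortest-path distance and its double sum *)

Section Distance.
Variable G : sgraph.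
Implicit Types x y z : G.

Lemma dist_le_path x p : path (@adj G) x p -> dist x (last x p) <= size p.
Proof.
move=> pP; have [_ Hmin] : joined_by_path x (last x p) (dist x (last x p)) /\
    forall m, joined_by_path x (last x p) m -> dist x (last x p) <= m.
  by apply: distP; apply/connectP; exists p.
case: (shortenP pP) Hmin => q qP qU sub Hmin.
apply: leq_trans (uniq_leq_size _ sub); last by case/andP: qU.
by apply: Hmin; apply/existsP; exists (in_tuple q); apply/and3P; split.
Qed.

Lemma dist_path x y : connect (@adj G) x y ->
  exists p, [/\ path (@adj G) x p, last x p = y & size p = dist x y].
Proof.
move=> /distP[/existsP[p /and3P[pP /eqP pl _]] _].
by exists p; split=> //; rewrite size_tuple.
Qed.

Lemma distxx x : dist x x = 0.
Proof. by apply/eqP; rewrite -leqn0 (@dist_le_path x [::]). Qed.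

Lemma dist_gt0 x y : connect (@adj G) x y -> (0 < dist x y) = (x != y).
Proof.
move=> xy; have [<-|neq] := eqVneq x y; first by rewrite distxx.
rewrite lt0n; apply/eqP => d0; case: (dist_path xy) => p [_ pl].
by rewrite d0 => /size0nil p0; move: pl neq; rewrite p0 /= => ->; rewrite eqxx.
Qed.

Lemma dist_adj x y : adj x y -> dist x y = 1.
Proof.
move=> a; have pP : path (@adj G) x [:: y] by rewrite /= a.
apply/eqP; rewrite eqn_leq (dist_le_path pP) dist_gt0 ?connect1 //.
by apply/eqP => e; move: a; rewrite e adj_irrefl.
Qed.

Lemma dist1_adj x y : connect (@adj G) x y -> dist x y = 1 -> adj x y.
Proof.
move=> /dist_path[p [+ + +]] d1; rewrite d1.
by case: p => [|z [|t p]] //=; rewrite andbT => xz <-.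
Qed.

Lemma dist2_adj x y : connect (@adj G) x y -> dist x y = 2 ->
  exists2 z, adj x z & adj z y.
Proof.
move=> /dist_path[p [+ + +]] d2; rewrite d2.
by case: p => [|z [|t [|u p]]] //= /and3P[xz zt _] <- _; exists z.
Qed.

Lemma dist_le2 x y z : adj x z -> adj z y -> dist x y <= 2.
Proof. by move=> a b; apply: (@dist_le_path x [:: z; y]); rewrite /= a b. Qed.

(** Local certificate for a candidate distance [d]: some step towards [y] always lowers [d] by one,
    which builds a walk of length [d x y], and no step lowers it by more, so no walk is shorter. *)
Lemma dist_unique (d : G -> G -> nat) :
    (forall x, d x x = 0) ->
    (forall x y, x != y -> exists2 z, adj x z & d x y = (d z y).+1) ->
    (forall x y z, adj x z -> d x y <= (d z y).+1) ->
  forall x y, connect (@adj G) x y /\ dist x y = d x y.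
Proof.
move=> d0 dS dL.
have ex m x y : d x y = m ->
    exists p, [/\ path (@adj G) x p, last x p = y & size p = m].
  elim: m x => [|m IH] x dm; have [exy|neq] := eqVneq x y.
  - by exists [::].
  - by case: (dS _ _ neq) => z _; rewrite dm.
  - by move: dm; rewrite exy d0.
  case: (dS _ _ neq) => z xz; rewrite dm => -[/esym/IH[p [pP pl <-]]].
  by exists (z :: p); rewrite /= xz.
have le p x : path (@adj G) x p -> d x (last x p) <= size p.
  elim: p x => [|z p IH] x /=; first by rewrite d0.
  by case/andP=> xz /IH; have := dL x (last z p) z xz; lia.
move=> x y; have [p [pP pl ps]] := ex _ x y erefl.
have xy : connect (@adj G) x y by apply/connectP; exists p.
split=> //; apply/eqP; rewrite eqn_leq -{1}pl -ps dist_le_path //=.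
have [q [qP ql <-]] := dist_path xy.
by rewrite ps -ql le.
Qed.

(** Swapping coordinates matches the pairs of the two rank orders, by [distC], and the diagonal
    contributes 0. *)
Lemma double_wiener : (wiener G).*2 = \sum_(x : G) \sum_(y : G) dist x y.
Proof.
rewrite pair_big /= (bigID (fun p : G * G => enum_rank p.1 < enum_rank p.2)) /=.
rewrite -addnn; congr addn.
rewrite (bigID (fun p : G * G => p.1 == p.2)) /= [X in _ = X + _]big1 => [|p].
  rewrite add0n /wiener (reindex_inj (h := fun p : G * G => (p.2, p.1))) /=.
    apply: eq_big => [[x y]|[x y] _] /=; last by rewrite distC.
    rewrite -leqNgt ltn_neqAle andbC; congr (_ && ~~ _).
    by rewrite -(inj_eq enum_rank_inj) -val_eqE eq_sym.
  by move=> [x y] [z t] [-> ->].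
by case/andP=> _ /eqP->; rewrite distxx.
Qed.

End Distance.

(** * Isomorphism invariance *)

Section Isomorphism.

Lemma isomorphic_sym (G H : sgraph) : isomorphic G H -> isomorphic H G.
Proof.
case=> f [g fK gK] fA; exists g; first by exists f.
by move=> x y; rewrite -fA !gK.
Qed.

(** An injection into a set that is no larger is bijective. The map starts from [H] because the
    model graphs are sum types, on which it is defined by cases. *)
Lemma inj_isomorphic (G H : sgraph) (h : H -> G) :
    injective h -> #|G| <= #|H| -> (forall x y, adj (h x) (h y) = adj x y) ->
  isomorphic G H.
Proof.
move=> hI hc hA; apply: isomorphic_sym; exists h => //.
exact: inj_card_bij.
Qed.

Lemma dist_hom (G H : sgraph) (f : G -> H) x y :
    (forall x y, adj x y -> adj (f x) (f y)) -> connect (@adj G) x y ->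
  dist (f x) (f y) <= dist x y.
Proof.
move=> fA /dist_path[p [pP <- <-]]; rewrite -last_map -(size_map f).
by apply: dist_le_path; apply: homo_path pP.
Qed.

Lemma isomorphic_wiener (G H : sgraph) :
  connected G -> isomorphic G H -> wiener G = wiener H.
Proof.
move=> cG [f [g fK gK] fA].
have cH : connected H.
  move=> x y; rewrite -[x]gK -[y]gK.
  have /connectP[p pP ->] := cG (g x) (g y).
  apply/connectP; exists (map f p); last by rewrite last_map.
  by apply: homo_path pP => u v; rewrite fA.
apply: double_inj; rewrite !double_wiener.
have fb : {on predT, bijective f} by exists g => ? _.
rewrite [RHS](reindex f) //=; apply: eq_bigr => x _.
rewrite [RHS](reindex f) //=; apply: eq_bigr => y _.
apply/eqP; rewrite eqn_leq dist_hom ?andbT //; last by move=> u v; rewrite fA.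
rewrite -{1}[x]fK -{1}[y]fK dist_hom // => u v.
by rewrite -fA !gK.
Qed.

End Isomorphism.

(** * Pendant vertices and close pairs *)

Section Pendant.
Variable G : sgraph.
Hypothesis cG : connected G.
Implicit Types x y z : G.

Lemma pendantP x : pendant x -> exists y, forall z, adj x z = (z == y).
Proof.
move=> /cards1P[y /setP Hy]; exists y => z.
by have := Hy z; rewrite !inE.
Qed.

Lemma pendant_uniq x y z : pendant x -> adj x y -> adj x z -> y = z.
Proof. by case/pendantP=> t Ht; rewrite !Ht => /eqP-> /eqP->. Qed.

(** Induction along a walk from [x]. It serves to rule out proper subsets closed under adjacency. *)
Lemma closed_full (A : {set G}) x :
  x \in A -> (forall y z, y \in A -> adj y z -> z \in A) -> A = setT.
Proof.
move=> xA Acl; apply/setP=> y; rewrite inE.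
have /connectP[p pP ->] := cG x y.
by elim: p x xA pP => //= z p IH x xA /andP[xz]; apply: IH; apply: Acl xz.
Qed.

(** Two adjacent pendant vertices would form a whole component. *)
Lemma pendant_adj x y : 2 < #|G| -> pendant x -> adj x y -> ~~ pendant y.
Proof.
move=> G2 px xy; apply/negP=> py.
have E : [set x; y] = setT.
  apply: (@closed_full _ x); first by rewrite set21.
  move=> z t /set2P[] -> zt.
    by rewrite (pendant_uniq px zt xy) set22.
  by rewrite (@pendant_uniq y t x) ?set21 // adj_sym.
by move: G2; rewrite -cardsT -E cards2; case: eqP.
Qed.

Lemma exists_adj x : 1 < #|G| -> exists y, adj x y.
Proof.
move=> G1; have [/existsP //|] := boolP [exists y, adj x y].
rewrite negb_exists => /forallP nA.
have E : [set x] = setT.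
  apply: (@closed_full _ x) => [|y z /set1P->]; first by rewrite set11.
  by rewrite (negbTE (nA z)).
by move: G1; rewrite -cardsT -E cards1.
Qed.

(** Otherwise [y] is the only neighbour [x] can have; connectedness supplies one, so [x] would be
    pendant. *)
Lemma nonpendant_adj x y : 1 < #|G| -> ~~ pendant x ->
  exists2 z, adj x z & z != y.
Proof.
move=> G1 /negP npx.
have [/existsP[z /andP[]]|] := boolP [exists z, adj x z && (z != y)].
  by exists z.
rewrite negb_exists => /forallP nA; case: npx; apply/cards1P; exists y.
have ex z : adj x z -> z = y.
  by move=> xz; have := nA z; rewrite xz /= negbK => /eqP.
apply/setP=> z; rewrite !inE; apply/idP/eqP=> [|->]; first exact: ex.
by have [t xt] := exists_adj x G1; rewrite -(ex t xt).
Qed.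

Definition close x y := (x != y) && (adj x y || ~~ pendant x && ~~ pendant y).

Lemma dist_close_ge x y : 2 * (x != y) <= dist x y + close x y.
Proof.
rewrite /close; have [//|neq] := eqVneq x y.
have := dist_gt0 (cG x y); rewrite neq /=.
case a: (adj x y) => /=; first by rewrite dist_adj.
have : dist x y <> 1 by move/(dist1_adj (cG x y)); rewrite a.
lia.
Qed.

Lemma sum_neq (A : {set G}) : \sum_(x in A) \sum_(y in A) (x != y) = #|A| * #|A|.-1.
Proof.
rewrite -sum_nat_const; apply: eq_bigr => x xA.
rewrite (cardsD1 x A) xA /= -sum1_card (bigID (fun y => x == y)) /=.
rewrite big1 ?add0n => [|y /andP[_ ->] //].
apply: eq_big => [y|y /andP[_ ->] //].
by rewrite !inE andbC eq_sym.
Qed.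

(** Split by pendant or not: pendant pairs contribute 0, each of the two mixed blocks [k] (one
    neighbour per pendant vertex), and every pair of distinct nonpendant vertices is close. *)
Lemma sum_close n k : in_H n k G -> 2 < n ->
  \sum_x \sum_y close x y = (n - k) * (n - k).-1 + 2 * k.
Proof.
case=> _ Gn Pk n2; set P := [set x : G | pendant x] in Pk.
have cP : #|~: P| = n - k by rewrite -Gn -Pk -(cardsC P); lia.
have np x y : x \in P -> y \in P -> adj x y = false.
  rewrite !inE => px py; apply/negP => /(pendant_adj _ px).
  by rewrite Gn py; move/(_ n2).
have degP x : x \in P -> \sum_(y in ~: P) close x y = 1.
  rewrite inE => /[dup] px /eqP <-; rewrite /degree -sum1_card.
  rewrite [RHS](eq_bigl (fun y => (y \in ~: P) && adj x y)).
    rewrite [RHS]big_mkcondr; apply: eq_bigr => y _.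
    rewrite /close px /= orbF; case a: (adj x y); rewrite ?andbF //.
    by have [e|] := eqVneq x y; rewrite // -e adj_irrefl in a.
  move=> y; rewrite inE; case a: (adj x y); rewrite ?andbF //.
  by rewrite !inE (pendant_adj _ px a) ?Gn.
have splitP (F : G -> nat) :
    \sum_x F x = \sum_(x in P) F x + \sum_(x in ~: P) F x.
  rewrite (bigID (mem P)) /=; congr addn.
  by apply: eq_bigl => x; rewrite !inE.
have closeC x y : close x y = close y x.
  by rewrite /close eq_sym adj_sym andbC [~~ _ && _]andbC andbC.
rewrite splitP.
under eq_bigr => x xP.
  rewrite splitP [X in X + _]big1 ?degP //; first over.
  move=> y yP; rewrite /close np //; move: xP; rewrite inE => ->.
  by rewrite andbF.
rewrite sum1_card Pk.
under [X in _ + X]eq_bigr do rewrite splitP.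
(* Exchanging the sums turns the second mixed block into one sum per pendant vertex, equal to 1 by
   symmetry of [close]. *)
rewrite big_split /= exchange_big /=.
rewrite (eq_bigr (fun=> 1)); last first.
  by move=> x xP; rewrite -(degP _ xP); apply: eq_bigr => y _; rewrite closeC.
rewrite sum1_card Pk -cP -sum_neq addnA addnn mul2n addnC; congr addn.
apply: eq_bigr => x; rewrite !inE => px; apply: eq_bigr => y; rewrite !inE => py.
by rewrite /close px py orbT andbT.
Qed.

End Pendant.

(** * Distances in P_n^k *)

Section GraphP.
Variables n k : nat.
Hypothesis nk : 2 < n - k.
Let H := graphP n k.
Let c : H := inl (Ordinal (ltnW (ltnW nk))).

Lemma card_graphP : #|H| = n.
Proof. by rewrite card_sum !card_ord; lia. Qed.

Lemma adj_graphP_center x : x != c -> adj x c.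
Proof. by case: x. Qed.

Lemma connected_graphP : connected H.
Proof.
have xc x : connect (@adj H) x c.
  by have [->|/adj_graphP_center/connect1] := eqVneq x c.
move=> x y; apply: connect_trans (xc x) _.
by rewrite sym_connect_sym; [exact: xc | exact: adj_sym].
Qed.

Lemma pendant_graphP_inr i : pendant (inr i : H).
Proof.
apply/cards1P; exists c; apply/setP=> -[v|j]; rewrite !inE //=.
Qed.

(** The clique has at least three vertices, so each of them has at least two neighbours inside
    it. *)
Lemma pendant_graphP_inl v : pendant (inl v : H) = false.
Proof.
apply/negbTE; rewrite /pendant /degree neq_ltn; apply/orP; right.
have : 1 < #|(inl : _ -> H) @: [set~ v]|.
  by rewrite card_imset ?cardsC1 ?card_ord; [lia | move=> ? ? []].
move/leq_trans; apply; apply/subset_leq_card/subsetP => _ /imsetP[u + ->].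
by rewrite !inE eq_sym.
Qed.

Lemma in_H_graphP : in_H n k H.
Proof.
split; [exact: connected_graphP | exact: card_graphP |].
have -> : [set x : H | pendant x] = (inr : _ -> H) @: [set: 'I_k].
  apply/setP=> -[v|i]; rewrite inE.
    by rewrite pendant_graphP_inl; apply/esym/imsetP => -[].
  by rewrite pendant_graphP_inr imset_f.
by rewrite card_imset ?cardsT ?card_ord // => ? ? [].
Qed.

(** Here the close pairs are exactly the adjacent ones, and two distinct nonadjacent vertices have
    [c] as a common neighbour. *)
Lemma dist_close_graphP (x y : H) : dist x y + close x y = 2 * (x != y).
Proof.
rewrite /close; have [->|neq] := eqVneq x y; first by rewrite distxx.
have gt0 := dist_gt0 (connected_graphP x y); rewrite neq in gt0.
have cl : ~~ pendant x && ~~ pendant y -> adj x y.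
  case: x y neq {gt0} => [u|i] [v|j]; rewrite ?pendant_graphP_inr ?andbF //=.
have [a|na] := boolP (adj x y); first by rewrite dist_adj.
rewrite (contraNF cl) //= addn0; apply/eqP; rewrite eqn_leq.
have le2 : dist x y <= 2.
  have [e|xc] := eqVneq x c.
    by move: na; rewrite e adj_sym adj_graphP_center // -e eq_sym.
  have [e|yc] := eqVneq y c; first by move: na; rewrite e adj_graphP_center.
  apply: (@dist_le2 _ x y c); first exact: adj_graphP_center.
  by rewrite adj_sym adj_graphP_center.
rewrite le2 /=; have : dist x y <> 1.
  by move/(dist1_adj (connected_graphP x y)); rewrite (negbTE na).
by move/eqP: gt0; case: (dist x y) => [|[]].
Qed.

End GraphP.

(** * The lower bound for k <= n - 3 and its equality case *)

(** Sum of [dist_close_ge] over ordered pairs. The form [?= iff] keeps the equality condition: every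
    single pair is tight. *)
Lemma sum_dist_close_ge n k G : in_H n k G -> 2 < n ->
  2 * (n * n.-1) <= (wiener G).*2 + ((n - k) * (n - k).-1 + 2 * k)
    ?= iff [forall x : G, forall y : G, dist x y + close x y == 2 * (x != y)].
Proof.
move=> HG n2; have [cG Gn _] := HG.
rewrite -(sum_close cG HG n2) double_wiener -big_split /=.
have -> : 2 * (n * n.-1) = \sum_(x : G) \sum_(y : G) 2 * (x != y).
  rewrite -Gn -cardsT -sum_neq big_distrr /=.
  apply: eq_big => [x|x _]; first by rewrite inE.
  by rewrite big_distrr; apply: eq_bigl => y; rewrite inE.
apply: leqif_sum => x _; rewrite -big_split /=.
apply: leqif_sum => y _; split; first exact: dist_close_ge.
by rewrite eq_sym.
Qed.

Lemma sum_dist_close_graphP n k : 2 < n - k ->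
  2 * (n * n.-1) =
    (wiener (graphP n k)).*2 + ((n - k) * (n - k).-1 + 2 * k).
Proof.
move=> nk; have n2 : 2 < n by lia.
have [_] := sum_dist_close_ge (in_H_graphP nk) n2.
have -> : [forall x : graphP n k, forall y : graphP n k,
    dist x y + close x y == 2 * (x != y)].
  by apply/forallP=> x; apply/forallP=> y; apply/eqP; exact: dist_close_graphP.
by move/eqP.
Qed.

Lemma wiener_graphP n k : 2 < n - k ->
  wiener (graphP n k) = 'C(n - k, 2) + k ^ 2 + 2 * k * (n - k - 1).
Proof.
move=> nk; have := bin_ffact (n - k) 2.
rewrite ffactnS ffactn1 -mulnn; have := sum_dist_close_graphP nk.
(* Substituting [n = m + k] with [m] a successor turns the truncated subtractions into polynomial
   arithmetic. *)
have -> : n = n - k + k by lia.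
rewrite addnK; move: (n - k) nk => m m2; rewrite (_ : 2`! = 2) //.
have [m' ->] : exists m', m = m'.+1 by exists m.-1; lia.
by rewrite -mul2n /=; nia.
Qed.

(* In the equality case two pendant vertices are at distance 2, so they have a
   common neighbour, which is the unique neighbour of each. *)
Lemma isomorphic_graphP n k (G : sgraph) : in_H n k G -> 2 < n - k ->
    (forall x y : G, dist x y + close x y = 2 * (x != y)) ->
  isomorphic G (graphP n k).
Proof.
move=> [cG Gn Pk] nk dG; set P := [set x : G | pendant x] in Pk.
have G2 : 2 < #|G| by lia.
have cP : #|~: P| = n - k by rewrite -Gn -Pk -(cardsC P); lia.
have clique x y : x \in ~: P -> y \in ~: P -> adj x y = (x != y).
  rewrite !inE => px py; have [->|neq] := eqVneq x y; first exact: adj_irrefl.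
  apply: (dist1_adj (cG x y)).
  by have := dG x y; rewrite /close neq px py orbT /=; lia.
have np x y : x \in P -> y \in P -> adj x y = false.
  rewrite !inE => px py; apply/negP => /(pendant_adj cG G2 px).
  by rewrite py.
have [c cNP Hc] : exists2 c, c \in ~: P & forall x, x \in P -> adj x c.
  (* Without pendant vertices any nonpendant vertex can play [c]; otherwise [c] is the neighbour of
     some pendant [p]. *)
  have [P0|[p pP]] := set_0Vmem P.
    have /card_gt0P[c cNP] : 0 < #|~: P| by lia.
    by exists c => // x; rewrite P0 inE.
  have pp : pendant p by rewrite inE in pP.
  have [c pc] := exists_adj cG p (ltnW G2).
  exists c; first by rewrite !inE (pendant_adj cG G2 pp pc).
  move=> q qP; have [<- //|neq] := eqVneq p q.
  have /(dist2_adj (cG p q))[z pz zq] : dist p q = 2.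
    have := dG p q; rewrite /close neq np //=.
    by move: pP; rewrite inE => ->; lia.
  by rewrite (pendant_uniq pp pc pz) adj_sym.
(* [c] comes first, so that [h] below sends vertex 0 of the model clique to [c]. The default of
   [nth] is never reached, since [size s = n - k]. *)
pose s := c :: enum (~: P :\ c).
have us : uniq s by rewrite /= enum_uniq mem_enum !inE eqxx.
have ss : size s = n - k by rewrite /= -cardE -cP (cardsD1 c (~: P)) cNP.
have sP x : (x \in s) = (x \in ~: P).
  rewrite in_cons mem_enum in_setD1.
  by have [->|] := eqVneq x c; rewrite ?cNP.
pose h (x : graphP n k) : G := match x with
  | inl v => nth c s v
  | inr i => enum_val (cast_ord (esym Pk) i)
  end.
have hl v : h (inl v) \in ~: P by rewrite -sP mem_nth // ss.
have hr i : h (inr i) \in P by apply: enum_valP.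
have hll u v : (h (inl u) == h (inl v)) = (u == v).
  by rewrite nth_uniq ?ss.
have hlr u i : h (inl u) <> h (inr i).
  by move=> e; have := hl u; rewrite e inE hr.
have hlP v i : adj (h (inl v)) (h (inr i)) = (val v == 0).
  rewrite adj_sym; have -> : (val v == 0) = (h (inl v) == c).
    by rewrite -[X in _ = (_ == X)]/(nth c s 0) nth_uniq // ss //; lia.
  apply/idP/eqP=> [|->]; last exact: Hc.
  have := hr i; rewrite inE => pi a; exact: pendant_uniq pi a (Hc _ (hr i)).
apply: (@inj_isomorphic G (graphP n k) h).
- move=> [u|i] [v|j] e; first by move/eqP: e; rewrite hll => /eqP->.
  + by case: (hlr _ _ e).
  + by case: (hlr _ _ (esym e)).
  + by move/enum_val_inj/cast_ord_inj: e => ->.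
- by rewrite card_graphP ?Gn.
- move=> [u|i] [v|j]; first by rewrite clique // hll.
  + exact: hlP.
  + by rewrite adj_sym hlP.
  + exact: np.
Qed.

(** * Distances and Wiener index of T(a,b,2) *)

Section GraphT.
Variables a b : nat.
Let H := graphT a b 2.
(* The distance in a double broom: one step for each end that is a leaf, one
   for crossing the central edge. *)
Let leaf (x : H) : bool := if x is inl _ then false else true.
Let side (x : H) : bool := match x with
  | inl v => val v != 0
  | inr (inl _) => false
  | inr (inr _) => true
  end.

Lemma card_graphT : #|H| = a + b + 2.
Proof. by rewrite !card_sum !card_ord; lia. Qed.

(** Checked through [dist_unique]. The factor [x != y] corrects the formula for a leaf paired with
    itself, where the sum is 2. *)
Lemma dist_graphT (x y : H) : connect (@adj H) x y /\
  dist x y = (x != y) * (leaf x + leaf y + (side x (+) side y)).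
Proof.
(* [u s] is the end of the central edge on side [s]. *)
pose u s : H := inl (if s then ord_max else ord0 : 'I_2).
have adjE z t : adj z t =
    (z != t) && (leaf z + leaf t + (side z (+) side t) == 1).
  case: z t => [[[|[|z]] iz]|[i|i]] [[[|[|t]] it]|[j|j]] //=.
  - by rewrite andbF.
  - by rewrite andbF.
have eqI z t : leaf z = false -> leaf t = false -> side z = side t -> z = t.
  case: z t => [[[|[|z]] iz]|//] [[[|[|t]] it]|//] //= _ _ _; congr inl;
  exact: val_inj.
apply: (dist_unique (d := fun x y : H =>
  (x != y) * (leaf x + leaf y + (side x (+) side y)))) => {x y} [x|x y neq|x y z].
- by rewrite eqxx.
(* The neighbour of [x] nearer to [y]: the central end on its side if [x] is a leaf, else the
   opposite end if [y] lies across, else [y] itself, which must then be a leaf. *)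
- case lx: (leaf x).
    exists (u (side x)).
      by rewrite adjE; case: (x) lx => [//|[i|i]].
    have -> : side (u (side x)) = side x by case: (side x).
    rewrite neq; have [e|neqy] := eqVneq (u (side x)) y.
      by rewrite -e /=; case: (side x).
    by rewrite !mul1n.
  case ss: (side x (+) side y).
    exists (u (~~ side x)).
      by rewrite adjE lx; case: (x) lx => [[[|[|v]] iv]|].
    rewrite neq; have [e|neqy] := eqVneq (u (~~ side x)) y.
      by rewrite -e.
    have -> : side (u (~~ side x)) = side y.
      by case: (side x) (side y) ss => [] [].
    by rewrite addbb !mul1n /= !addn0 addn1.
  have ly : leaf y.
    case ly: (leaf y) => //; move/eqP: neq; case; apply: eqI => //.
    by case: (side x) (side y) ss => [] [].
  exists y; last by rewrite eqxx neq ly.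
  by rewrite adjE neq lx ly ss.
- rewrite adjE => /andP[neq /eqP e].
  have [exy|nxy] := eqVneq x y; first by [].
  have [ezy|nzy] := eqVneq z y; first by rewrite -ezy e.
  move: e; rewrite !mul1n.
  by case: (leaf x) (leaf y) (leaf z) (side x) (side y) (side z) => [] [] [] [] [] [].
Qed.

Lemma wiener_graphT : wiener H = (a + b + 1) ^ 2 + a * b.
Proof.
have sumH (F : H -> nat) : \sum_x F x = F (inl ord0) + F (inl ord_max) +
    (\sum_i F (inr (inl i)) + \sum_j F (inr (inr j))).
  rewrite big_sumType big_sumType /= 2!big_ord_recl big_ord0 addn0.
  by congr (_ + F (inl _) + _); apply: val_inj.
(* Dropping the factor [x != y] adds 2 for each of the [a + b] leaves, on the diagonal only. *)
have : \sum_(x : H) \sum_(y : H) (leaf x + leaf y + (side x (+) side y)) =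
    (wiener H).*2 + (a + b).*2.
  rewrite double_wiener.
  have -> : (a + b).*2 = \sum_(x : H) 2 * leaf x.
    by rewrite sumH /= !sum_nat_const !card_ord -mul2n; lia.
  rewrite -big_split; apply: eq_bigr => x _ /=.
  rewrite !(bigD1 (P := predT) x) //= distxx add0n addbb addn0 addnn -mul2n addnC.
  congr addn; apply: eq_bigr => y neq.
  by have [_ ->] := dist_graphT x y; rewrite eq_sym neq mul1n.
(* The last term counts the vertices on the other side: its leaves and one end of the central
   edge. *)
have row (x : H) : \sum_(y : H) (leaf x + leaf y + (side x (+) side y)) =
    (a + b + 2) * leaf x + (a + b) + (if side x then a else b).+1.
  by rewrite sumH /= !sum_nat_const !card_ord; case: (side x) => /=; nia.
rewrite (eq_bigr _ (fun x _ => row x)) sumH /= !sum_nat_const !card_ord -mulnn.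
nia.
Qed.

End GraphT.

(** * Graphs with n - 2 pendant vertices *)

(** Each pendant vertex hangs at one of the two nonpendant vertices; [a] and [b] count the two
    groups. The order [a <= b] lets the minimal case be read off as [a = 1]. *)
Lemma isomorphic_graphT n (G : sgraph) : in_H n (n - 2) G -> 4 <= n ->
  exists a b, [/\ 0 < a, a <= b, a + b = n - 2 & isomorphic G (graphT a b 2)].
Proof.
move=> [cG Gn Pk] n4; set P := [set x : G | pendant x] in Pk.
have G2 : 2 < #|G| by lia.
have /cards2P[u0 [v0 [neq0 NP]]] : #|~: P| == 2.
  by apply/eqP; have := cardsC P; lia.
pose leaves x := [set y in P | adj x y].
wlog le_uv : u0 v0 neq0 NP / #|leaves u0| <= #|leaves v0|.
  move=> IH; case/orP: (leq_total #|leaves u0| #|leaves v0|) => le.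
    exact: IH le.
  by apply: (IH v0 u0) le; rewrite 1?eq_sym // setUC.
move: u0 v0 neq0 NP le_uv => u v neq NP le_uv.
have npE x : ~~ pendant x = (x == u) || (x == v).
  by have /setP/(_ x) := NP; rewrite !inE.
have nu : ~~ pendant u by rewrite npE eqxx.
have nv : ~~ pendant v by rewrite npE eqxx orbT.
have np x y : pendant x -> adj x y -> (y == u) || (y == v).
  by move=> px xy; rewrite -npE; exact: pendant_adj px xy.
(* Otherwise [u] with its leaves is closed under adjacency and misses [v]. *)
have uv : adj u v.
  apply/negPn/negP => nuv.
  have E : u |: leaves u = setT.
    apply: (closed_full cG (setU11 _ _)) => y z /setU1P[->|].
      move=> uz; rewrite !inE uz andbT; case: (boolP (pendant z)); rewrite ?orbT //.
      by rewrite npE orbF => /orP[//|/eqP e]; rewrite -e uz in nuv.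
    rewrite !inE => /andP[py uy] yz; rewrite (@pendant_uniq _ y z u) ?eqxx //.
    by rewrite adj_sym.
  have /setP/(_ v) := E.
  by rewrite !inE (negbTE nv) eq_sym (negbTE neq).
have leavesI x y : x \in leaves u -> y \in leaves v -> x <> y.
  rewrite !inE => /andP[px ux] /andP[_ vy] e; move: neq.
  by rewrite (@pendant_uniq _ x u v) ?eqxx // adj_sym // e.
have leavesU : leaves u :|: leaves v = P.
  apply/setP=> x; rewrite !inE; case px: (pendant x) => //=.
  have [y xy] := exists_adj cG x (ltnW G2).
  by case/orP: (np _ _ px xy) => /eqP<-; rewrite (adj_sym y) xy ?orbT.
have leavesIuv : leaves u :&: leaves v = set0.
  by apply/setP=> x; rewrite in_setI in_set0; apply/andP => -[/leavesI H /H].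
have sum_leaves : #|leaves u| + #|leaves v| = n - 2.
  by rewrite -Pk -leavesU -cardsUI leavesIuv cards0 addn0.
(* Being nonpendant, [u] has a neighbour besides [v], which must be a leaf. *)
have u_gt0 : 0 < #|leaves u|.
  have [z uz zv] := nonpendant_adj cG v (ltnW G2) nu.
  apply/card_gt0P; exists z; rewrite !inE uz andbT.
  apply/negPn; rewrite npE (negbTE zv) orbF; apply/eqP => e.
  by move: uz; rewrite e adj_irrefl.
exists #|leaves u|, #|leaves v|; split=> //.
pose h (x : graphT #|leaves u| #|leaves v| 2) : G := match x with
  | inl i => if val i == 0 then u else v
  | inr (inl i) => enum_val i
  | inr (inr i) => enum_val i
  end.
have pP i : pendant (h (inr i)).
  by case: i => i; have := enum_valP i; rewrite inE => /andP[]; rewrite inE.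
have npP i : ~~ pendant (h (inl i)) by rewrite /=; case: ifP.
have hlr i j : h (inl i) <> h (inr j).
  by move=> e; have := npP i; rewrite e pP.
have hlu (i : 'I_#|leaves u|) : adj u (enum_val i) /\ ~~ adj v (enum_val i).
  have iu := enum_valP i; have := iu; rewrite inE => /andP[iP ->]; split=> //.
  by apply/negP => vi; apply: (leavesI _ (enum_val i) iu) => //; rewrite inE iP.
have hlv (i : 'I_#|leaves v|) : adj v (enum_val i) /\ ~~ adj u (enum_val i).
  have iv := enum_valP i; have := iv; rewrite inE => /andP[iP ->]; split=> //.
  by apply/negP => ui; apply: (leavesI (enum_val i) _ _ iv) => //; rewrite inE iP.
have hadj i j : adj (h (inl i)) (h (inr j)) = @adj (graphT _ _ 2) (inl i) (inr j).
  case: i j => [[|[|i]] ii] [j|j] //=;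
  by [case: (hlu j) => ? /negbTE | case: (hlv j) => ? /negbTE].
apply: (@inj_isomorphic G (graphT #|leaves u| #|leaves v| 2) h).
- move=> [i|i] [j|j] e; try by [case: (hlr _ _ e) | case: (hlr _ _ (esym e))].
    case: i j e => [[|[|i]] ii] [[|[|j]] jj] //= e; first 1 last.
    + by rewrite e eqxx in neq.
    + by rewrite e eqxx in neq.
    + by congr inl; apply: val_inj.
    + by congr inl; apply: val_inj.
  case: i j e => [i|i] [j|j] /= e.
  + by rewrite (enum_val_inj e).
  + by case: (leavesI _ _ (enum_valP i) (enum_valP j)).
  + by case: (leavesI _ _ (enum_valP j) (enum_valP i)).
  + by rewrite (enum_val_inj e).
- by rewrite card_graphT Gn; lia.
- move=> [i|i] [j|j].
  + case: i j => [[|[|i]] ii] [[|[|j]] jj] //=; rewrite ?adj_irrefl //.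
    by rewrite adj_sym.
  + exact: hadj.
  + by rewrite adj_sym hadj.
  + apply/negbTE/negP => a; have := pendant_adj cG G2 (pP i) a.
    by rewrite pP.
Qed.

(** * Minimality and uniqueness in both cases *)

Theorem theorem1p2 (n k : nat) (hn : 4 <= n) (hk : k <= n - 2) :
  (k <= n - 3 ->
     (forall G : sgraph, in_H n k G ->
        wiener (graphP n k) <= wiener G /\
        (wiener (graphP n k) = wiener G <-> isomorphic G (graphP n k))) /\
     wiener (graphP n k) = 'C(n - k, 2) + k ^ 2 + 2 * k * (n - k - 1))
  /\
  (k = n - 2 ->
     (forall G : sgraph, in_H n k G ->
        wiener (graphT 1 (n - 3) 2) <= wiener G /\
        (wiener (graphT 1 (n - 3) 2) = wiener G <->
           isomorphic G (graphT 1 (n - 3) 2))) /\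
     wiener (graphT 1 (n - 3) 2) = n ^ 2 - n - 2).
Proof.
split=> [kn|kE].
  have nk : 2 < n - k by lia.
  have n2 : 2 < n by lia.
  split; last exact: wiener_graphP.
  move=> G HG; have [cG _ _] := HG.
  have [geG eqG] := sum_dist_close_ge HG n2.
  have WP := sum_dist_close_graphP nk.
  (* The number of close pairs is the same for [G] and P_n^k, so it cancels. *)
  split; first by move: geG; rewrite WP leq_add2r leq_double.
  split=> [W|]; last by move/(isomorphic_wiener cG).
  (* Equal Wiener indices make the summed bound an equality, so every pair of [G] is tight. *)
  move: eqG; rewrite WP W eqxx => /esym/forallP tightG.
  apply: isomorphic_graphP HG nk _ => x y.
  exact/eqP/(forallP (tightG x)).
have W1 : wiener (graphT 1 (n - 3) 2) = n ^ 2 - n - 2.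
  rewrite wiener_graphT -!mulnn; have [m ->] : exists m, n = m + 3.
    by exists (n - 3); lia.
  by rewrite addnK; nia.
split=> // G; rewrite kE => HG; have [cG _ _] := HG.
have [a [b [a0 ab abn isoG]]] := isomorphic_graphT HG hn.
have WG := isomorphic_wiener cG isoG.
(* With [a + b] fixed the squares agree, and the indices differ by a * b - (a + b - 1) = (a - 1) *
   (b - 1). *)
rewrite WG !wiener_graphT (_ : 1 + (n - 3) = a + b); last by lia.
split; first by nia.
split=> [W|isoG1].
  (* One of the two factors vanishes, and [a <= b] gives [a = 1] either way. *)
  have a1 : a = 1 by nia.
  by move: isoG; rewrite a1 (_ : b = n - 3) //; lia.
by move: (isomorphic_wiener cG isoG1); rewrite WG !wiener_graphT; nia.
Qed.
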